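(* Let $X$ be a Hausdorff space and let $I\subset\mathbb{R}$ be an interval closed and bounded on the left with left end point $t_0$. Let $\mathcal{U}$ be a subset of $\mathcal{X}=\mathcal{C}_{\mathrm{loc}}(I,X)$ and let $X_0$ be a Borel subset of $X$. Suppose that (H1') $\Pi_{t_0}\mathcal{U}\supset X_0$. Suppose, also, that there exists a family $\mathfrak{K}'(X_0)$ of compact subsets of $X_0$ such that (H2') every tight Borel probability measure $\mu_0$ on $X$ which is carried by $X_0$ is inner regular with respect to the family $\mathfrak{K}'(X_0)$; (H3') for every $K\in\mathfrak{K}'(X_0)$, the set $\Pi_{t_0}^{-1}K\cap\mathcal{U}$ is compact in $\mathcal{X}$. Then, for any tight Borel probability measure $\mu_0$ on $X$ which is carried by $X_0$, there exists a $\mathcal{U}$-trajectory statistical solution $\rho$ over $I$ such that $\Pi_{t_0}\rho=\mu_0$.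
   Context: For a topological space $X$, $\mathfrak{B}_X$ denotes its Borel $\sigma$-algebra. A Borel measure $\mu$ on $X$ is inner regular with respect to a family $\mathfrak{F}\subset\mathfrak{B}_X$ if $\mu(A)=\sup\{\mu(F): F\in\mathfrak{F},\ F\subset A\}$ for every $A\in\mathfrak{B}_X$; it is tight if it is nonnegative and inner regular with respect to the family of all compact subsets of $X$. A measure $\mu$ is carried by a measurable set $C$ if $\mu(X\setminus C)=0$. For a Hausdorff space $X$ and an interval $I\subset\mathbb{R}$, $\mathcal{X}=\mathcal{C}_{\mathrm{loc}}(I,X)$ is the set of all continuous functions $u:I\to X$ endowed with the compact-open topology, i.e. the topology generated by the subbase of sets $\{u: u(J)\subset O\}$ with $J\subset I$ a compact subinterval and $O\subset X$ open. For $t\in I$, $\Pi_t:\mathcal{X}\to X$ is the (continuous) map $\Pi_tu=u(t)$, and for a Borel measure $\rho$ on $\mathcal{X}$, $\Pi_t\rho$ is the push-forward $\Pi_t\rho(A)=\rho(\Pi_t^{-1}(A))$, $A\in\mathfrak{B}_X$. Given a subset $\mathcal{U}\subset\mathcal{X}$, a $\mathcal{U}$-trajectory statistical solution over $I$ is a Borel probability measure $\rho$ on $\mathcal{X}$ such that (i) $\rho$ is tight, and (ii) there exists $\mathcal{V}\in\mathfrak{B}_{\mathcal{X}}$ with $\mathcal{V}\subset\mathcal{U}$ and $\rho(\mathcal{X}\setminus\mathcal{V})=0$. *)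

(* Defs.v *)
From HB Require Import structures.
From mathcomp Require Import all_boot all_order all_algebra.
From mathcomp Require Import all_classical all_reals all_analysis.
Import Order.TTheory GRing.Theory Num.Theory numFieldNormedType.Exports.

Set Implicit Arguments.
Unset Strict Implicit.
Unset Printing Implicit Defensive.

Local Open Scope classical_set_scope.
Local Open Scope ring_scope.

Section Cloc.
Context {R : realType} (I : set R).

Definition Cloc (X : topologicalType) := continuousType I X.

HB.instance Definition _ (X : topologicalType) := Choice.on (Cloc X).
HB.instance Definition _ (X : topologicalType) :=
  Topological.copy (Cloc X)
    (initial_topology (id : Cloc X -> {compact-open, I -> X})).

(* Measurable types are pointed in the library. *)
Definition cst_Cloc (X : topologicalType) (x : X) : Cloc X := cst x.
HB.instance Definition _ (X : ptopologicalType) :=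
  isPointed.Build (Cloc X) (cst_Cloc point).

Definition Pi (X : topologicalType) (t : I) (u : Cloc X) : X := u t.

Definition subsegment (a b : I) : set I :=
  [set t | \val a <= \val t <= \val b].

Context (I_itv : is_interval I).

Lemma subsegment_compact (a b : I) : compact (subsegment a b).
Proof.
move=> F PF FJ.
have PG : ProperFilter (set_val @ F) by exact: fmap_proper_filter.
have [] := @segment_compact R (\val a) (\val b) (set_val @ F) PG.
  apply: (@filterS _ F) FJ => t /=; by rewrite in_itv.
move=> p [+ clp]; rewrite /= in_itv /= => pab.
have Ip : I p.
  by apply: I_itv pab; apply: set_mem; apply: valP.
exists (exist _ p (mem_set Ip)); split => //.
move=> A B FA [_ [[W oW <-] Wp WB]].
have [] := clp (set_val @` A) W; last first.
- by move=> _ [[t At <-] Wt]; exists t; split => //; exact: WB.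
- exact: open_nbhs_nbhs.
- by apply: (@filterS _ F) FA => t At; exists t.
Qed.

(* The library's compact-open topology uses all compact subsets of I; compact
   subintervals generate the same topology. *)
Lemma Cloc_cvgP (X : topologicalType) (F : set_system (Cloc X)) (u : Cloc X) :
  Filter F ->
  F --> u <-> forall (a b : I) (O : set X), open O ->
    u @` subsegment a b `<=` O -> F [set v : Cloc X | v @` subsegment a b `<=` O].
Proof.
move=> FF; split.
  move=> Fu a b O oO uO; apply: Fu.
  pose B : set {compact-open, I -> X} :=
    [set g | g @` subsegment a b `<=` O].
  have oB : open B by apply: compact_open_open oO; exact: subsegment_compact.
  by exists [set v : Cloc X | B v]; split => //; exists B.
move=> FO A [_ [[W oW <-] Wu WA]]; apply: (filterS WA).
have FFid : Filter ((id : Cloc X -> {compact-open, I -> X}) @ F).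
  exact: fmap_filter.
have /(_ W) : (id : Cloc X -> {compact-open, I -> X}) @ F -->
    (u : {compact-open, I -> X}); last first.
  by apply; exact: open_nbhs_nbhs.
apply/compact_open_cvgP => {A W oW Wu WA} K O cK oO uKO.
have [->|/set0P K0] := eqVneq K set0.
  by rewrite nbhs_simpl /=; apply: filterS filterT => v _ _ [t []].
have cval (B : set I) : {within B, continuous (set_val : I -> R)}.
  by apply: continuous_subspaceT; exact: initial_continuous.
have [M KM maxM] := compact_EVT_max K0 cK (cval K).
have [m Km minm] := compact_EVT_min K0 cK (cval K).
suff : \near F, K `<=` (fun v : Cloc X => O \o v) F.
  by apply: filterS => v vKO _ [t Kt <-]; exact: vKO.
have /near_covering_withinP := (compact_near_coveringP K).1 cK.
apply => // x Kx.
have nO : nbhs (u x) O.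
  by apply: open_nbhs_nbhs; split => //; apply: uKO; exists x.
have [_ [[W oW <-] Wx WO]] := @cts_fun _ _ u x O nO.
have [e e0 eW] : exists2 e : R, 0 < e & forall y, `|y - \val x| <= e -> W y.
  have /nbhs_closedballP : nbhs (\val x) W by apply: open_nbhs_nbhs.
  move=> [e eW]; exists e%:num => // y ye; apply: eW.
  by rewrite closed_ballE // /closed_ball_ /= distrC.
have xI : I (\val x) by apply: set_mem; apply: valP.
have mI : I (\val m) by apply: set_mem; apply: valP.
have MI : I (\val M) by apply: set_mem; apply: valP.
have mx : \val m <= \val x by apply: minm; rewrite inE.
have xM : \val x <= \val M by apply: maxM; rewrite inE.
have Ia : I (Num.max (\val m) (\val x - e)).
  apply: (I_itv mI xI); rewrite le_max lexx /= ge_max mx /=.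
  by rewrite lerBlDr lerDl ltW.
have Ib : I (Num.min (\val M) (\val x + e)).
  apply: (I_itv xI MI); rewrite ge_min lexx /= andbT le_min xM /=.
  by rewrite lerDl ltW.
pose a : I := exist (fun y => y \in I) _ (mem_set Ia).
pose b : I := exist (fun y => y \in I) _ (mem_set Ib).
have abO : F [set v : Cloc X | v @` subsegment a b `<=` O].
  apply: FO => // _ [t /= + <-]; rewrite /subsegment /=.
  rewrite ge_max le_min => /andP[/andP[_ h1] /andP[_ h2]]; apply: WO.
  by apply: eW; rewrite ler_distl h1.
exists ([set t : I | `|\val x - \val t| < e],
    [set v : Cloc X | v @` subsegment a b `<=` O]).
  split => //=.
  have xe : nbhs (\val x) (ball (\val x) e) by exact: nbhsx_ballx.
  exact: (@initial_continuous I R set_val x _ xe).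
move=> [t v] /= [xt vO Kt]; apply: vO; exists t => //.
have mt : \val m <= \val t by apply: minm; rewrite inE.
have tM : \val t <= \val M by apply: maxM; rewrite inE.
move: (ltW xt); rewrite distrC ler_distl => /andP[h1 h2].
by rewrite /subsegment /= ge_max le_min mt h1 tM h2.
Qed.

End Cloc.

Notation borel T := (g_sigma_algebraType (@open T)).

Section borel_measures.
Context {R : realType} {T : ptopologicalType}.
Implicit Type mu : {measure set (borel T) -> \bar R}.

(* The supremum is taken in [0, +oo]: it is 0 if no member of FF is included
   in A. *)
Definition inner_regular mu (FF : set (set T)) :=
  forall A : set (borel T), measurable A ->
    mu A = ereal_sup (0%E |` [set mu F | F in [set F | FF F /\ F `<=` A]]).

Definition tight mu := inner_regular mu compact.

Definition carried_by mu (C : set T) := mu (~` C) = 0%E.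
End borel_measures.

Definition trajectory_statistical_solution {R : realType} {I : set R}
    {X : ptopologicalType} (U : set (Cloc I X))
    (rho : probability (borel (Cloc I X)) R) :=
  tight rho /\
  exists V : set (borel (Cloc I X)),
    [/\ measurable V, V `<=` U & carried_by rho V].

(* Main.v *)
(* Consider all set functions l on the subsets of a Hausdorff space Y that are
   monotone and supermodular, with l set0 = 0 and l setT = 1, and that are inner
   regular with respect to compact sets.  Chains of such functions have upper
   bounds, and for K closed the function
     E |-> l (E `|` ~` K) - l (~` K) + l (E `\` K)
   is again of this kind and dominates l.  Hence a maximal l satisfies
   l K + l (~` K) = 1 for every closed K.  Supermodularity makes the sets A with
   l A + l (~` A) = 1 an algebra on which l is additive; compactness makes l
   continuous from above, so these sets form a sigma-algebra containing the Borel
   sets and l restricts to a tight Borel probability measure.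

   The theorem follows by starting from
     E |-> sup {mu0 A | A Borel, Pi t0 @^-1` A `&` U `<=` E},
   which is inner regular by (H2) and (H3): the limit measure is at least mu0 A on
   Pi t0 @^-1` A and at least mu0 (~` A) on the complement, so it projects to mu0;
   its mass on U is 1, so it is carried by a countable union of compact subsets
   of U. *)
From HB Require Import structures.
Require Import Defs.
From mathcomp Require Import all_boot all_order all_algebra.
From mathcomp Require Import all_classical all_reals all_analysis.
From mathcomp Require Import finmap lra.
Import Order.TTheory GRing.Theory Num.Theory numFieldNormedType.Exports.

Set Implicit Arguments.
Unset Strict Implicit.
Unset Printing Implicit Defensive.

Local Open Scope classical_set_scope.
Local Open Scope ring_scope.

Lemma compact_bigcap_setI_eq0 (Y : ptopologicalType) (L : set Y)
    (D : nat -> set Y) :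
  compact L -> (forall n, closed (D n)) ->
  (forall m n, (m <= n)%N -> D n `<=` D m) ->
  L `<=` ~` (\bigcap_n D n) -> exists n, L `&` D n = set0.
Proof.
rewrite compact_In0 => /= cL cD decD LD; apply: contrapT => /forallNP LDn0.
have /cL [] : closed_fam_of L setT (fun n => L `&` D n) by exists D.
  move=> s _; have /eqP/set0P[x [Lx Dx]] := LDn0 (\max_(i <- s) i)%N.
  exists x => i /= si; split => //; apply: decD Dx.
  by rewrite (big_rem i si) /= leq_maxl.
move=> x LDx; have [Lx _] := LDx 0%N I.
by apply: (LD x Lx) => n _; have [] := LDx n I.
Qed.

(** * Tight supermodular set functions and their maximal elements *)

Section tight_supermodular.
Context {R : realType} {Y : ptopologicalType}.
Hypothesis hY : hausdorff_space Y.
Implicit Types (l : set Y -> R) (A B E K : set Y).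

Record tight_supermodular l : Prop := TightSupermodular {
  tsm_set0 : l set0 = 0;
  tsm_setT : l setT = 1;
  tsm_le : forall A B, A `<=` B -> l A <= l B;
  tsm_setUI : forall A B, l A + l B <= l (A `|` B) + l (A `&` B);
  tsm_compact : forall A e, 0 < e ->
    exists C, [/\ compact C, C `<=` A & l A - e < l C]
}.

Lemma tsm_le1 l A : tight_supermodular l -> l A <= 1.
Proof. by move=> tl; rewrite -(tsm_setT tl); apply: tsm_le. Qed.

Lemma tsm_ge0 l A : tight_supermodular l -> 0 <= l A.
Proof. by move=> tl; rewrite -(tsm_set0 tl); apply: tsm_le. Qed.

Lemma tsm_chain (F : set (set Y -> R)) : F !=set0 ->
  (forall l, F l -> tight_supermodular l) ->
  (forall l l', F l -> F l' ->
     (forall E, l E <= l' E) \/ (forall E, l' E <= l E)) ->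
  tight_supermodular (fun E => sup [set l E | l in F]).
Proof.
move=> [l0 Fl0] tF totF.
have ubF E : ubound [set l E | l in F] 1.
  by move=> _ [l Fl <-]; apply: tsm_le1; apply: tF.
have neF E : [set l E | l in F] !=set0 by exists (l0 E); exists l0.
have hF E : has_sup [set l E | l in F] by split => //; exists 1.
have leF l E : F l -> l E <= sup [set l E | l in F].
  by move=> Fl; apply: ub_le_sup; [exists 1|exists l].
have adh E e : 0 < e ->
    exists2 l, F l & sup [set l E | l in F] - e < l E.
  by move=> e0; have [_ [l Fl <-] ?] := sup_adherent e0 (hF E); exists l.
split.
- apply/eqP; rewrite eq_le; apply/andP; split; last first.
    by rewrite -(tsm_set0 (tF _ Fl0)); exact: leF.
  by apply: ge_sup => // _ [l Fl <-]; rewrite (tsm_set0 (tF _ Fl)).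
- apply/eqP; rewrite eq_le; apply/andP; split; first exact: ge_sup.
  by rewrite -(tsm_setT (tF _ Fl0)); exact: leF.
- move=> A B AB; apply: ge_sup => // _ [l Fl <-].
  by apply: le_trans (leF _ _ Fl); apply: tsm_le AB; exact: tF.
- move=> A B; apply/ler_addgt0Pr => e e0.
  have e20 : 0 < e / 2 by lra.
  have [l1 Fl1 l1A] := adh A _ e20.
  have [l2 Fl2 l2B] := adh B _ e20.
  (* Totality of the chain lets a single member be nearly optimal for [A] and [B] at once. *)
  have [l [Fl lA lB]] : exists l, [/\ F l, l1 A <= l A & l2 B <= l B].
    by case: (totF _ _ Fl1 Fl2) => ?; [exists l2|exists l1].
  have := tsm_setUI (tF _ Fl) A B.
  have := leF _ (A `|` B) Fl; have := leF _ (A `&` B) Fl.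
  lra.
- move=> A e e0; have e20 : 0 < e / 2 by lra.
  have [l Fl lA] := adh A _ e20.
  have [C [cC CA lC]] := tsm_compact (tF _ Fl) A e20.
  by exists C; split => //; have := leF _ C Fl; lra.
Qed.

(* K carries the largest mass compatible with l, its complement the smallest. *)
Definition adjoin K l E := l (E `|` ~` K) - l (~` K) + l (E `\` K).

Lemma adjoin_ge K l E : tight_supermodular l -> l E <= adjoin K l E.
Proof.
move=> tl; have := tsm_setUI tl E (~` K); rewrite /adjoin setDE; lra.
Qed.

Lemma tsm_adjoin K l :
  closed K -> tight_supermodular l -> tight_supermodular (adjoin K l).
Proof.
move=> cK tl; have tl' := tl; case: tl' => l0 l1 lle lUI lC; split.
- by rewrite /adjoin set0U set0D subrr l0 addr0.
- by rewrite /adjoin setTU setTD l1 subrK.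
- move=> A B AB; rewrite /adjoin lerD // ?lerD2r; apply: lle.
    exact: setSU.
  exact: setSD.
- move=> A B; rewrite /adjoin.
  have := lUI (A `|` ~` K) (B `|` ~` K); have := lUI (A `\` K) (B `\` K).
  rewrite -setUUl -setUIl -setDUl !setDE -setIIl.
  lra.
- move=> A e e0; have e20 : 0 < e / 2 by lra.
  have [C [cC CA lAC]] := lC (A `|` ~` K) _ e20.
  have [D [cD DA lAD]] := lC (A `\` K) _ e20.
  exists ((C `&` K) `|` D); split.
  + by apply: compactU => //; exact: compact_closedI.
  + by move=> y [[/CA[//|nKy] Ky]|/DA[]].
  + rewrite /adjoin.
    have : l C <= l (C `&` K `|` D `|` ~` K).
      apply: lle => x Cx; have [Kx|nKx] := pselect (K x); last by right.
      by left; left.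
    have : l D <= l ((C `&` K `|` D) `\` K).
      by apply: lle => x Dx; split; [right|have [] := DA _ Dx].
    lra.
Qed.

Lemma tsm_maximal l0 : tight_supermodular l0 ->
  exists l, [/\ tight_supermodular l, forall E, l0 E <= l E &
    forall K, closed K -> l K + l (~` K) = 1].
Proof.
move=> tl0.
pose T := {l | tight_supermodular l /\ forall E, l0 E <= l E}.
pose t0 : T := exist _ l0 (conj tl0 (fun E => lexx (l0 E))).
pose le (s t : T) := `[< forall E, sval s E <= sval t E >].
have [||A totA|t tmax] := @ZL_preorder T t0 le.
- by move=> t; apply/asboolP.
- move=> r s t /asboolP rs /asboolP st; apply/asboolP => E.
  exact: le_trans (rs E) (st E).
- have [->|/set0P[a Aa]] := eqVneq A set0; first by exists t0.
  pose F := sval @` A.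
  have tF : forall l, F l -> tight_supermodular l.
    by move=> _ [s _ <-]; case: (svalP s).
  have tl : tight_supermodular (fun E => sup [set l E | l in F]).
    apply: tsm_chain => //; first by exists (sval a); exists a.
    move=> _ _ [s As <-] [t At <-].
    by case: (totA s t As At) => /asboolP; [left|right].
  have leF s E : A s -> sval s E <= sup [set l E | l in F].
    move=> As; apply: ub_le_sup; last by exists (sval s) => //; exists s.
    by exists 1 => _ [l /tF tl' <-]; exact: tsm_le1.
  have l0le E : l0 E <= sup [set l E | l in F].
    by apply: le_trans (leF a E Aa); case: (svalP a).
  exists (exist (fun l => tight_supermodular l /\ forall E, l0 E <= l E)
    _ (conj tl l0le)) => s As; apply/asboolP => E /=.
  exact: leF.
case: t tmax => l [tl l0l] tmax; exists l; split => // K cK.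
have l0a E : l0 E <= adjoin K l E by exact: le_trans (adjoin_ge _ _ tl).
pose s : T := exist _ (adjoin K l) (conj (tsm_adjoin cK tl) l0a).
have /asboolP /(_ K) : le s (exist _ l (conj tl l0l)).
  by apply: tmax; apply/asboolP => E; exact: adjoin_ge.
have := tsm_setUI tl K (~` K).
by rewrite /= /adjoin setUv setICr setDv (tsm_setT tl) (tsm_set0 tl); lra.
Qed.

(** * From a maximal set function to a Borel probability measure *)

Section measure_of_tsm.
Variable l : set Y -> R.
Hypothesis tl : tight_supermodular l.
Hypothesis lclosed : forall K, closed K -> l K + l (~` K) = 1.

(** Continuity from above. The [B n] are shrunk to decreasing compact sets [D n] at total cost [e];
    a compact set nearly exhausting the complement of their intersection misses some [D n], which
    bounds its mass by [1 - l (D n)]. *)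
Lemma tsm_bigcap (B : nat -> set Y) (c : R) :
  (forall m n, (m <= n)%N -> B n `<=` B m) -> (forall n, c <= l (B n)) ->
  c <= l (\bigcap_n B n).
Proof.
move=> decB cB; apply/ler_addgt0Pr => e' e'0.
pose e := e' / 2; have e0 : 0 < e by rewrite /e; lra.
have /choice[C CP] : forall n, exists C,
    [/\ compact C, C `<=` B n & l (B n) - e * 2^-1 ^+ n.+1 < l C].
  by move=> n; apply: tsm_compact => //; rewrite mulr_gt0 // exprn_gt0.
pose fix D n := if n is m.+1 then D m `&` C n else C 0%N.
have DC n : D n `<=` C n by case: n => //= n x [].
have DB n : D n `<=` B n.
  by apply: subset_trans (DC n) _; have [] := CP n.
have decD m n : (m <= n)%N -> D n `<=` D m.
  elim: n => [|n IH]; first by rewrite leqn0 => /eqP ->.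
  rewrite leq_eqVlt => /predU1P[->//|/IH]; apply: subset_trans.
  by move=> x [].
have cD n : compact (D n).
  elim: n => [|n IH]; first by have [] := CP 0%N.
  apply: compact_closedI => //; apply: compact_closed => //.
  by have [] := CP n.+1.
have clD n : closed (D n) by exact: compact_closed.
(* The losses [e / 2], [e / 4], ... of [C 0], ..., [C n] add up, by supermodularity of [l] on [D n]
   and [C n.+1], both inside [B n]. *)
have lD n : l (B n) - e * (1 - 2^-1 ^+ n.+1) <= l (D n).
  elim: n => [|n IH].
    by have [_ _] := CP 0%N; rewrite /D expr1; lra.
  have [_ CB] := CP n.+1; have := tsm_setUI tl (D n) (C n.+1).
  have : l (D n `|` C n.+1) <= l (B n).
    apply: tsm_le => // x [/DB//|/CB]; exact: decB.
  move: IH; rewrite /= !(exprS _ n.+1); set h := 2^-1 ^+ n.+1; lra.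
pose D' := \bigcap_n D n.
have D'B : l D' <= l (\bigcap_n B n).
  by apply: tsm_le => // x Dx n _; apply: DB; exact: Dx.
have clD' : closed D' by apply: closed_bigI => n _.
have [L [cL LD lL]] := tsm_compact tl (~` D') e0.
have [n LDn] := compact_bigcap_setI_eq0 cL clD decD LD.
have := tsm_setUI tl L (D n); have := tsm_le1 (L `|` D n) tl.
rewrite LDn (tsm_set0 tl).
have := lclosed clD'; have := cB n; have := lD n.
have : 0 <= e * 2^-1 ^+ n.+1 by rewrite mulr_ge0 // ?exprn_ge0 // ltW.
rewrite /e in lL *; lra.
Qed.

Let M : set (set Y) := [set A | l A + l (~` A) = 1].

Lemma tsm_modular A B : M A -> M B ->
  l (A `|` B) + l (A `&` B) = l A + l B /\ M (A `|` B).
Proof.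
rewrite /M /= => MA MB.
have disj E : l E + l (~` E) <= 1.
  by have := tsm_setUI tl E (~` E);
    rewrite setUv setICr (tsm_setT tl) (tsm_set0 tl) addr0.
have := tsm_setUI tl A B; have := tsm_setUI tl (~` A) (~` B).
rewrite -setCI -setCU; have := disj (A `|` B); have := disj (A `&` B).
by split; lra.
Qed.

Lemma tsm_sigma_algebra : sigma_algebra setT M.
Proof.
have MC A : M A -> M (~` A) by rewrite /M /= setCK addrC.
have M0 : M set0.
  by rewrite /M /= setC0 (tsm_set0 tl) (tsm_setT tl) add0r.
split => //; first by move=> A; rewrite setTD; exact: MC.
move=> A MA; pose B n := \big[setU/set0]_(i < n.+1) A i.
have MB n : M (B n).
  rewrite /B; elim/big_ind : _ => // E F ME MF.
  by have [] := tsm_modular ME MF.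
have decB m n : (m <= n)%N -> ~` (B n) `<=` ~` (B m).
  move=> mn; apply: subsetC; rewrite /B; exact: subset_bigsetU.
have UB : \bigcap_n ~` (B n) = ~` (\bigcup_n A n).
  rewrite -setC_bigcup; congr (~` _).
  apply/seteqP; split => x [n _].
    by rewrite /B -bigcup_mkord => -[i _ Aix]; exists i.
  by move=> Anx; exists n => //; rewrite /B -bigcup_mkord; exists n => //=.
have := @tsm_bigcap (fun n => ~` B n) (1 - l (\bigcup_n A n)) decB.
rewrite UB => H; have {}H : 1 - l (\bigcup_n A n) <= l (~` (\bigcup_n A n)).
  apply: H => n; have := MB n; rewrite /M /=.
  have : l (B n) <= l (\bigcup_n A n); last by lra.
  by apply: tsm_le => //; rewrite /B -bigcup_mkord => x [i _ Aix]; exists i.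
have := tsm_setUI tl (\bigcup_n A n) (~` (\bigcup_n A n)).
rewrite setUv setICr (tsm_set0 tl) (tsm_setT tl) /M /=; lra.
Qed.

Lemma tsm_measurable (A : set (borel Y)) : measurable A -> M A.
Proof.
apply: smallest_sub; first exact: tsm_sigma_algebra.
by move=> O oO; rewrite /M /= addrC -{2}(setCK O); apply: lclosed;
  exact: open_closedC.
Qed.

(* The proof arguments let the measure instances be attached to this constant. *)
Definition tsm_measure of tight_supermodular l &
    (forall K, closed K -> l K + l (~` K) = 1) : set (borel Y) -> \bar R :=
  fun A => (l A)%:E.

Local Notation mu := (tsm_measure tl lclosed).

Let mu0 : mu set0 = 0%E. Proof. by rewrite /tsm_measure (tsm_set0 tl). Qed.

Let mu_ge0 A : (0 <= mu A)%E.
Proof. by rewrite /tsm_measure lee_fin; exact: tsm_ge0. Qed.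

Let mu_sigma_additive : semi_sigma_additive mu.
Proof.
move=> F mF tF mUF.
pose B n := \big[setU/set0]_(i < n) F i.
have lB n : (\sum_(0 <= i < n) mu (F i))%E = (l (B n))%:E.
  rewrite big_mkord /B; elim: n => [|n IH].
    by rewrite !big_ord0 (tsm_set0 tl).
  rewrite !big_ord_recr /= {}IH /tsm_measure -EFinD.
  have MB : M (\big[setU/set0]_(i < n) F i).
    by apply: tsm_measurable; apply: bigsetU_measurable => i _.
  have [<- _] := tsm_modular MB (tsm_measurable (mF n)).
  suff -> : \big[setU/set0]_(i < n) F i `&` F n = set0.
    by rewrite (tsm_set0 tl) addr0.
  rewrite -bigcup_mkord setI_bigcupl bigcup0 // => i /= ltin.
  by have /trivIsetP := tF; apply => //; rewrite neq_ltn ltin.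
under eq_fun do rewrite lB.
rewrite /tsm_measure; apply: cvg_EFin; first exact: nearW.
have BU n : l (B n) <= l (\bigcup_n F n).
  by apply: tsm_le => //; rewrite /B -bigcup_mkord => x [i _ Fix]; exists i.
have ndB : {homo (fun n => l (B n)) : m n / (m <= n)%N >-> m <= n}.
  by move=> m n mn; apply: tsm_le => //; exact: subset_bigsetU.
have MU := tsm_measurable mUF.
have lU : l (\bigcup_n F n) = sup (range (fun n => l (B n))).
  apply/eqP; rewrite eq_le; apply/andP; split; last first.
    by apply: ge_sup => [|_ [n _ <-]//]; exists (l (B 0%N)); exists 0%N.
  set s := sup _.
  (* Continuity from below at the union is continuity from above for the complements. *)
  have : 1 - s <= l (\bigcap_n ~` B n).
    apply: tsm_bigcap => [m n mn|n].
      by apply: subsetC; exact: subset_bigsetU.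
    have : M (B n).
      by apply: tsm_measurable; apply: bigsetU_measurable => i _.
    have : l (B n) <= s.
      by apply: ub_le_sup; [exists (l (\bigcup_n F n)) => _ [m _ <-]|exists n].
    rewrite /M /=; lra.
  rewrite -setC_bigcup -(_ : \bigcup_n F n = \bigcup_n B n).
    by move: MU; rewrite /M /=; lra.
  apply/seteqP; split => x [n _]; last first.
    by rewrite /B -bigcup_mkord => -[i _ ?]; exists i.
  by move=> ?; exists n.+1 => //; rewrite /B -bigcup_mkord; exists n => //=.
rewrite lU; apply: nondecreasing_cvgn => //.
by exists (l (\bigcup_n F n)) => _ [n _ <-]; exact: BU.
Qed.

HB.instance Definition _ := isMeasure.Build _ (borel Y) R mu
  mu0 mu_ge0 mu_sigma_additive.

Let mu_setT : mu setT = 1%E.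
Proof. by rewrite /tsm_measure (tsm_setT tl). Qed.

HB.instance Definition _ :=
  Measure_isProbability.Build _ (borel Y) R mu mu_setT.

Lemma tsm_probability : exists P : probability (borel Y) R,
  forall A, P A = (l A)%:E.
Proof. by exists mu. Qed.

End measure_of_tsm.
End tight_supermodular.

(** * Borel sets and inner regularity *)

Section borel_facts.
Context {R : realType}.

Lemma open_borel (T : ptopologicalType) (A : set (borel T)) :
  open (A : set T) -> measurable A.
Proof. exact: sub_sigma_algebra. Qed.

Lemma closed_borel (T : ptopologicalType) (A : set (borel T)) :
  closed (A : set T) -> measurable A.
Proof.
move=> cA; rewrite -(setCK A); apply: measurableC; apply: open_borel.
exact: closed_openC.
Qed.

Lemma continuous_borel_measurable (S T : ptopologicalType) (f : S -> T) :
  continuous f -> measurable_fun setT (f : borel S -> borel T).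
Proof.
move=> /continuousP cf.
apply: (@measurability _ _ (borel S) (borel T) setT f (@open T)) => //.
by move=> _ [W oW <-]; rewrite setTI; apply: open_borel; exact: cf.
Qed.

(** The first alternative covers the value 0 adjoined to the supremum in [inner_regular]. *)
Lemma inner_regular_adherent (T : ptopologicalType)
    (mu : probability (borel T) R) (FF : set (set T))
    (A : set (borel T)) (e : R) :
  inner_regular mu FF -> measurable A -> 0 < e ->
  (mu A < e%:E)%E \/
  exists F, [/\ FF F, F `<=` A & (mu A - e%:E < mu (F : set (borel T)))%E].
Proof.
move=> muFF mA e0.
have : (mu A - e%:E < mu A)%E.
  by rewrite gte_subl ?lte_fin // fin_num_measure.
rewrite {2}(muFF A mA) => /ereal_sup_gt[_ [->|[F [FFF FA] <-]] muA].
  by left; rewrite -suber_lt0.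
by right; exists F.
Qed.

End borel_facts.

(** * Tight lifting of a measure along a continuous map *)

Section lift.
Context {R : realType} {X Y : ptopologicalType}.
Hypotheses (hX : hausdorff_space X) (hY : hausdorff_space Y).
Variables (p : Y -> X) (U : set Y) (mu : probability (borel X) R).
Variables (X0 : set (borel X)) (KK : set (set X)).
Hypotheses (cp : continuous p) (X0U : X0 `<=` p @` U).
Hypotheses (mX0 : measurable X0) (muX0 : carried_by mu X0).
Hypothesis (muKK : inner_regular mu KK).
Hypothesis (KKcompact : forall K, KK K -> compact K).
Hypothesis (KKU : forall K, KK K -> compact (p @^-1` K `&` U)).

Let m (A : set (borel X)) : R := fine (mu A).

Let mE A : measurable A -> mu A = (m A)%:E.
Proof. by move=> mA; rewrite /m fineK // fin_num_measure. Qed.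

Let m_le A B : measurable A -> measurable B -> A `<=` B -> m A <= m B.
Proof.
move=> mA mB AB; rewrite -lee_fin -!mE //.
by apply: le_measure => //; exact: mem_set.
Qed.

Let mUI A B : measurable A -> measurable B ->
  m A + m B = m (A `|` B) + m (A `&` B).
Proof.
move=> mA mB; apply: EFin_inj; rewrite !EFinD -!mE //; last 2 first.
- exact: measurableI.
- exact: measurableU.
rewrite measureUfinl // ?subeK // ?fin_num_measure //; first exact: measurableI.
by rewrite ltey_eq fin_num_measure.
Qed.

Let below (E : set Y) : set (set (borel X)) :=
  [set A : set (borel X) | measurable A /\ p @^-1` A `&` U `<=` E].

(** Being defined on all subsets, it makes sense at [U], which need not be Borel. *)
Definition pullback_content (E : set Y) : R := sup (m @` below E).

Let below_ub E : has_ubound (m @` below E).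
Proof.
exists 1 => _ [A [mA _] <-].
by rewrite -lee_fin -mE //; exact: probability_le1.
Qed.

Let below0 E : below E set0.
Proof. by split=> // x []. Qed.

Let below_sup E : has_sup (m @` below E).
Proof. by split=> //; exists (m set0); exists set0. Qed.

Lemma pullback_content_ge E (A : set (borel X)) :
  measurable A -> p @^-1` A `&` U `<=` E -> m A <= pullback_content E.
Proof. by move=> mA AE; apply: ub_le_sup => //; exists A. Qed.

Let pullback_adherent E e : 0 < e ->
  exists2 A, below E A & pullback_content E - e < m A.
Proof.
by move=> e0; have [_ [A AE <-] ?] := sup_adherent e0 (below_sup E); exists A.
Qed.

Let KKmeasurable K : KK K -> measurable (K : set (borel X)).
Proof.
by move=> /KKcompact cK; apply: closed_borel; exact: compact_closed.
Qed.

Lemma tsm_pullback_content : tight_supermodular pullback_content.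
Proof.
have ge0 E : 0 <= pullback_content E.
  by have := @pullback_content_ge E set0 measurable0;
    rewrite preimage_set0 set0I {1}/m measure0; apply.
have mT : m setT = 1 by rewrite /m probability_setT.
split.
- apply/eqP; rewrite eq_le ge0 andbT; apply: ge_sup.
    by exists (m set0); exists set0.
  (* If no point of [U] lies over [A], then [A] misses [X0], hence is null. *)
  move=> _ [A [mA AU0] <-]; rewrite -lee_fin -mE // -[leRHS]muX0.
  apply: le_measure; [exact: mem_set|apply/mem_set; exact: measurableC|].
  by move=> x Ax /X0U[u Uu pu]; apply: (AU0 u); split => //=; rewrite pu.
- apply/eqP; rewrite eq_le; apply/andP; split.
    apply: ge_sup; first by exists (m set0); exists set0.
    move=> _ [A [mA _] <-]; rewrite -mT; exact: m_le.
  by rewrite -mT; exact: pullback_content_ge.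
- move=> E F EF; apply: ge_sup; first by exists (m set0); exists set0.
  move=> _ [A [mA AE] <-]; apply: pullback_content_ge => //.
  exact: subset_trans AE EF.
- move=> E F; apply/ler_addgt0Pr => e e0; have e20 : 0 < e / 2 by lra.
  have [A [mA AE] lA] := pullback_adherent E e20.
  have [B [mB BF] lB] := pullback_adherent F e20.
  have := mUI mA mB.
  have : m (A `|` B) <= pullback_content (E `|` F).
    apply: pullback_content_ge; first exact: measurableU.
    by move=> x [[Ax|Bx] Ux]; [left; apply: AE|right; apply: BF].
  have : m (A `&` B) <= pullback_content (E `&` F).
    apply: pullback_content_ge; first exact: measurableI.
    by move=> x [[Ax Bx] Ux]; split; [apply: AE|apply: BF].
  lra.
- move=> E e e0; have e20 : 0 < e / 2 by lra.
  have [A [mA AE] lA] := pullback_adherent E e20.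
  have [|[K [KKK KA]]] := inner_regular_adherent muKK mA e20.
    (* When [A] has mass below [e / 2], the empty set is already a good approximation. *)
    rewrite mE // lte_fin => mAe; exists set0; split => //.
      exact: compact0.
    by have := ge0 set0; lra.
  have mK := KKmeasurable KKK; rewrite !mE // -EFinB lte_fin => mAK.
  exists (p @^-1` K `&` U); split; first exact: KKU.
    by move=> x [/KA Ax Ux]; exact: AE.
  by have := @pullback_content_ge (p @^-1` K `&` U) K mK (fun _ => id); lra.
Qed.

Lemma exists_tight_lift : exists rho : probability (borel Y) R,
  [/\ tight rho,
    exists V : set (borel Y), [/\ measurable V, V `<=` U & carried_by rho V] &
    forall A : set (borel X), measurable A ->
      pushforward rho (p : borel Y -> borel X) A = mu A].
Proof.
have [l [tl cl lclosed]] := tsm_maximal tsm_pullback_content.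
have [rho rhoE] := tsm_probability hY tl lclosed.
have lC (A : set Y) : measurable (A : set (borel Y)) -> l A + l (~` A) = 1.
  exact: tsm_measurable.
have rhoE' A : (rho : {measure set (borel Y) -> \bar R}) A = (l A)%:E.
  exact: rhoE.
exists rho; split.
- move=> A mA; apply/eqP; rewrite eq_le; apply/andP; split.
    apply/lee_addgt0Pr => e e0; rewrite -leeBlDr //.
    have [C [cC CA lAC]] := tsm_compact tl A e0.
    apply: (@le_trans _ _ (rho C)).
      by rewrite rhoE rhoE' -EFinB lee_fin ltW.
    by apply: ereal_sup_ubound; right; exists C.
  apply: ge_ereal_sup => _ [->//|[C [cC CA] <-]].
  by rewrite !rhoE' lee_fin; exact: tsm_le.
- have lU : l U = 1.
    apply/eqP; rewrite eq_le tsm_le1 //=.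
    have <- : m setT = 1 by rewrite /m probability_setT.
    by apply: le_trans (cl U); apply: pullback_content_ge => // x [].
  (* Compact subsets of [U] of mass above [1 - e n] have a Borel union inside [U], and its
     complement has mass at most every [e n]. *)
  pose e (n : nat) : R := n.+1%:R^-1.
  have /choice[C CP] : forall n, exists C,
      [/\ compact C, C `<=` U & l U - e n < l C].
    by move=> n; apply: tsm_compact; rewrite // invr_gt0.
  have mC n : measurable (C n : set (borel Y)).
    by apply: closed_borel; apply: compact_closed => //; have [] := CP n.
  pose V : set Y := \bigcup_n C n.
  have mV : measurable (V : set (borel Y)) by exact: bigcup_measurable.
  exists V; split => //.
    by move=> x [n _]; have [_ CU _] := CP n; exact: CU.
  rewrite /carried_by rhoE'; congr _%:E.
  have lV : l V + l (~` V) = 1 := lC _ mV.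
  apply/eqP; change (l (~` V) == 0).
  rewrite eq_le (tsm_ge0 _ tl) andbT leNgt; apply/negP => V0.
  have [n nV] : exists n, e n < l (~` V).
    exists (Num.truncn (l (~` V))^-1).
    rewrite /e invf_plt ?posrE //; exact: truncnS_gt.
  have [_ _] := CP n; rewrite lU.
  have : l (C n) <= l V by apply: tsm_le => // x; exists n.
  lra.
- move=> A mA; rewrite /pushforward rhoE mE //; congr _%:E.
  have le_l B : measurable B -> m B <= l (p @^-1` B).
    move=> mB; apply: le_trans (cl _).
    by apply: pullback_content_ge => // x [].
  have mAC := measurableC mA.
  have : l (p @^-1` A) + l (~` (p @^-1` A)) = 1.
    apply: lC; rewrite -[X in measurable X]setTI.
    exact: (continuous_borel_measurable cp).
  have := le_l A mA; have := le_l _ mAC; rewrite preimage_setC.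
  have : m A + m (~` A) = 1.
    by rewrite mUI // setUv setICr /m probability_setT measure0 addr0.
  (* The two lower bounds, for [A] and its complement, both sum to 1, so they are attained. *)
  lra.
Qed.

End lift.

(** * Evaluation maps and separation in the trajectory space *)

Section Cloc_facts.
Context {R : realType} {I : set R} {X : ptopologicalType}.
Hypothesis I_itv : is_interval I.

Lemma continuous_Pi (t : I) : continuous (Pi t : Cloc I X -> X).
Proof.
move=> u W; rewrite /= nbhsE => -[V [oV Vu] VW].
have /(Cloc_cvgP I_itv _) /(_ t t V oV) : nbhs u --> u by [].
(* Evaluation at [t] is controlled by the degenerate segment [[t, t]]. *)
have tt (v : Cloc I X) : v @` subsegment t t `<=` V <-> V (v t).
  split => [|Vvt]; first by apply; exists t => //=; rewrite /subsegment /= lexx.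
  by move=> _ [s /= /le_anti st <-]; rewrite -(val_inj st).
move=> /(_ ((tt u).2 Vu)); apply: filterS => v /tt Vv; exact: VW.
Qed.

(** The continuous evaluations separate trajectories. *)
Lemma Cloc_hausdorff : hausdorff_space X -> hausdorff_space (Cloc I X).
Proof.
move=> hX u v uv; apply/continuousEP => t; apply: hX => A B Au Bv.
have [w [Aw Bw]] := uv _ _ (continuous_Pi Au) (continuous_Pi Bv).
by exists (Pi t w).
Qed.

End Cloc_facts.

Theorem theorem3p2 (R : realType) (X : ptopologicalType)
  (X_hausdorff : hausdorff_space X)
  (I : set R) (I_interval : is_interval I)
  (t0 : I) (t0_left : lbound I (\val t0))
  (U : set (Cloc I X))
  (X0 : set (borel X)) (X0_borel : measurable X0)
  (H1 : X0 `<=` Pi t0 @` U)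
  (K' : set (set X))
  (K'_compact : forall K, K' K -> compact K /\ K `<=` X0)
  (H2 : forall mu0 : probability (borel X) R,
     tight mu0 -> carried_by mu0 X0 -> inner_regular mu0 K')
  (H3 : forall K, K' K -> compact (Pi t0 @^-1` K `&` U))
  (mu0 : probability (borel X) R)
  (mu0_tight : tight mu0) (mu0_carried : carried_by mu0 X0) :
  exists rho : probability (borel (Cloc I X)) R,
    trajectory_statistical_solution U rho /\
    forall A : set (borel X), measurable A ->
      pushforward rho (Pi t0 : borel (Cloc I X) -> borel X) A = mu0 A.
Proof.
have [rho [trho V rhoPi]] := exists_tight_lift X_hausdorff
  (Cloc_hausdorff I_interval X_hausdorff) (@continuous_Pi _ _ _ I_interval t0)
  H1 X0_borel mu0_carried (H2 _ mu0_tight mu0_carried)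
  (fun K K'K => (K'_compact K K'K).1) H3.
by exists rho.
Qed.
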